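(* Let $T:\mathfrak h\to\mathfrak g$ be a relative Rota-Baxter operator of weight $1$ from a Lie-Yamaguti algebra $(\mathfrak h,[\cdot,\cdot]_{\mathfrak h},[\![\cdot,\cdot,\cdot]\!]_{\mathfrak h})$ to a Lie-Yamaguti algebra $(\mathfrak g,[\cdot,\cdot]_{\mathfrak g},[\![\cdot,\cdot,\cdot]\!]_{\mathfrak g})$ with respect to an action $(\rho,\mu)$ of $\mathfrak g$ on $\mathfrak h$. If two linear deformations $T^1_t=T+t\mathfrak T_1$ and $T^2_t=T+t\mathfrak T_2$ of $T$ are equivalent, then $\mathfrak T_1$ and $\mathfrak T_2$ are in the same cohomology class in the first cohomology group $\mathcal H^1_T(\mathfrak h,\mathfrak g)$.
   Context: All vector spaces are finite-dimensional over a field $\mathbb K$ of characteristic $0$. **Lie-Yamaguti algebra**: a vector space $\mathfrak g$ with a bilinear bracket $[\cdot,\cdot]:\wedge^2\mathfrak g\to\mathfrak g$ and a trilinear bracket $[\![\cdot,\cdot,\cdot]\!]:\wedge^2\mathfrak g\otimes\mathfrak g\to\mathfrak g$ (skew-symmetric in the first two arguments) such that for all $x,y,z,w,t$: (LY1) $[[x,y],z]+[[y,z],x]+[[z,x],y]+[\![x,y,z]\!]+[\![y,z,x]\!]+[\![z,x,y]\!]=0$; (LY2) $[\![[x,y],z,w]\!]+[\![[y,z],x,w]\!]+[\![[z,x],y,w]\!]=0$; (LY3) $[\![x,y,[z,w]]\!]=[[\![x,y,z]\!],w]+[z,[\![x,y,w]\!]]$; (LY4) $[\![x,y,[\![z,w,t]\!]]\!]=[\![[\![x,y,z]\!],w,t]\!]+[\![z,[\![x,y,w]\!],t]\!]+[\![z,w,[\![x,y,t]\!]]\!]$.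 A homomorphism of Lie-Yamaguti algebras is a linear map preserving both brackets. **Representation** of $\mathfrak g$: a vector space $V$ with linear $\rho:\mathfrak g\to\mathfrak{gl}(V)$ and bilinear $\mu:\otimes^2\mathfrak g\to\mathfrak{gl}(V)$ such that for all $x,y,z,w\in\mathfrak g$: $\mu([x,y],z)-\mu(x,z)\rho(y)+\mu(y,z)\rho(x)=0$; $\mu(x,[y,z])-\rho(y)\mu(x,z)+\rho(z)\mu(x,y)=0$; $\rho([\![x,y,z]\!])=[D(x,y),\rho(z)]$; $\mu(z,w)\mu(x,y)-\mu(y,w)\mu(x,z)-\mu(x,[\![y,z,w]\!])+D(y,z)\mu(x,w)=0$; $\mu([\![x,y,z]\!],w)+\mu(z,[\![x,y,w]\!])=[D(x,y),\mu(z,w)]$; where $D(x,y)=D_{\rho,\mu}(x,y):=\mu(y,x)-\mu(x,y)+[\rho(x),\rho(y)]-\rho([x,y])$. **Center** of a Lie-Yamaguti algebra $\mathfrak h$: $C(\mathfrak h)=\{x\in\mathfrak h: [x,y]=0,\ [\![x,y,z]\!]=0,\ [\![y,z,x]\!]=0\ \ \forall y,z\in\mathfrak h\}$. **Action** of $\mathfrak g$ on a Lie-Yamaguti algebra $(\mathfrak h,[\cdot,\cdot]_{\mathfrak h},[\![\cdot,\cdot,\cdot]\!]_{\mathfrak h})$: a pair $(\rho,\mu)$ such that $(\mathfrak h;\rho,\mu)$ is a representation of $\mathfrak g$ and for all $x,y\in\mathfrak g$, $u,v,w\in\mathfrak h$: $\rho(x)u,\ \mu(x,y)u\in C(\mathfrak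 h)$; $\rho(x)[u,v]_{\mathfrak h}=\mu(x,y)[u,v]_{\mathfrak h}=0$; $\rho(x)[\![u,v,w]\!]_{\mathfrak h}=\mu(x,y)[\![u,v,w]\!]_{\mathfrak h}=0$. **Relative Rota-Baxter operator of weight $1$** from $\mathfrak h$ to $\mathfrak g$ with respect to an action $(\rho,\mu)$ of $\mathfrak g$ on $\mathfrak h$: a linear map $T:\mathfrak h\to\mathfrak g$ such that for all $u,v,w\in\mathfrak h$ $[Tu,Tv]_{\mathfrak g}=T(\rho(Tu)v-\rho(Tv)u+[u,v]_{\mathfrak h})$, $[\![Tu,Tv,Tw]\!]_{\mathfrak g}=T(D(Tu,Tv)w+\mu(Tv,Tw)u-\mu(Tu,Tw)v+[\![u,v,w]\!]_{\mathfrak h})$. **Homomorphism from $T'$ to $T$** (both with respect to $(\rho,\mu)$): a pair $(\psi_{\mathfrak g},\psi_{\mathfrak h})$ of Lie-Yamaguti algebra homomorphisms $\psi_{\mathfrak g}:\mathfrak g\to\mathfrak g$, $\psi_{\mathfrak h}:\mathfrak h\to\mathfrak h$ with $\psi_{\mathfrak g}\circ T'=T\circ\psi_{\mathfrak h}$, $\psi_{\mathfrak h}(\rho(x)u)=\rho(\psi_{\mathfrak g}(x))\psi_{\mathfrak h}(u)$, $\psi_{\mathfrak h}(\mu(x,y)u)=\mu(\psi_{\mathfrak g}(x),\psi_{\mathfrak g}(y))\psi_{\mathfrak h}(u)$ for all $x,y\in\mathfrak g$, $u\in\mathfrak h$. **Linear deformation**: for a linear map $\mathfrak T:\mathfrak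 h\to\mathfrak g$, $T_t=T+t\mathfrak T$ is a linear deformation of $T$ if $T_t$ is a relative Rota-Baxter operator of weight $1$ with respect to $(\rho,\mu)$ for all $t$. **Equivalence**: $T^1_t$ and $T^2_t$ are equivalent if there is $\mathfrak X\in\wedge^2\mathfrak g$ such that $(\mathrm{Id}_{\mathfrak g}+t\mathfrak L(\mathfrak X),\mathrm{Id}_{\mathfrak h}+tD(\mathfrak X))$ is a homomorphism from $T^2_t$ to $T^1_t$ (for all $t$), where $\mathfrak L(x\wedge y)z=[\![x,y,z]\!]_{\mathfrak g}$, $D(x\wedge y)=D(x,y)$, extended linearly to $\wedge^2\mathfrak g$. **Descent structure and representation**: $T$ makes $\mathfrak h$ a Lie-Yamaguti algebra with $[u,v]_T=\rho(Tu)v-\rho(Tv)u+[u,v]_{\mathfrak h}$, $[\![u,v,w]\!]_T=D(Tu,Tv)w+\mu(Tv,Tw)u-\mu(Tu,Tw)v+[\![u,v,w]\!]_{\mathfrak h}$, with a representation on $\mathfrak g$ given by $\rho_T(u)(x)=[Tu,x]_{\mathfrak g}+T(\rho(x)u)$, $\mu_T(u,v)(x)=[\![x,Tu,Tv]\!]_{\mathfrak g}-T(D(x,Tu)v-\mu(x,Tv)u)$, $D_T(u,v)(x):=D_{\rho_T,\mu_T}(u,v)(x)=[\![Tu,Tv,x]\!]_{\mathfrak g}-T(\mu(Tv,x)u-\mu(Tu,x)v)$. **First cohomology group** of $T$: $\mathcal H^1_T(\mathfrak h,\mathfrak g)=\mathcal Z^1_T/\mathcal B^1_T$, where $\mathcal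 Z^1_T$ is the space of $f\in\mathrm{Hom}(\mathfrak h,\mathfrak g)$ with, for all $u,v,w\in\mathfrak h$, $\rho_T(u)f(v)-\rho_T(v)f(u)-f([u,v]_T)=0$ and $D_T(u,v)f(w)+\mu_T(v,w)f(u)-\mu_T(u,w)f(v)-f([\![u,v,w]\!]_T)=0$; and $\mathcal B^1_T$ is the image of the linear map $\partial:\wedge^2\mathfrak g\to\mathrm{Hom}(\mathfrak h,\mathfrak g)$, $\partial(x\wedge y)v=T(D(x,y)v)-[\![x,y,Tv]\!]_{\mathfrak g}$ (one has $\mathcal B^1_T\subseteq\mathcal Z^1_T$). *)

(* Defs.v *)
From HB Require Import structures.
From mathcomp Require Import all_boot all_order all_algebra boolp.

Set Implicit Arguments.
Unset Strict Implicit.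
Unset Printing Implicit Defensive.

Import GRing.Theory.
Local Open Scope ring_scope.
Local Open Scope quotient_scope.

(* The exterior square of V in coordinates over vbasis {:V}: X is stored as   *)
(* the family of its coefficients on e_i /\ e_j for i < j. The lemmas         *)
(* wedge_liftE and wedge_lift_uniq are its universal property.                *)
Section Wedge2.

Variables (K : fieldType) (V : vectType K).

Definition wedge_index :=
  {p : 'I_(\dim {:V}) * 'I_(\dim {:V}) | (p.1 < p.2)%N}.

Definition wedge2 := {ffun wedge_index -> K^o}.

Local Notation e := (vbasis {:V}).

Definition wedge (x y : V) : wedge2 :=
  [ffun p : wedge_index => coord e (val p).1 x * coord e (val p).2 y
                           - coord e (val p).2 x * coord e (val p).1 y].

Section Lift.

Variables (W : vectType K) (phi : V -> V -> W).

Definition wedge_lift_fun (X : wedge2) : W :=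
  \sum_(p : wedge_index) X p *: phi e`_(val p).1 e`_(val p).2.

(* The linear extension of x /\ y |-> phi x y. *)
Definition wedge_lift : 'Hom(wedge2, W) := linfun wedge_lift_fun.

Fact wedge_lift_fun_linear : linear wedge_lift_fun.
Proof.
move=> a X Y; rewrite /wedge_lift_fun scaler_sumr -big_split /=.
by apply: eq_bigr => p _; rewrite !ffunE scalerDl scalerA.
Qed.

HB.instance Definition _ :=
  GRing.isLinear.Build K wedge2 W _ wedge_lift_fun wedge_lift_fun_linear.

Lemma wedge_lift_sum X :
  wedge_lift X = \sum_(p : wedge_index) X p *: phi e`_(val p).1 e`_(val p).2.
Proof. by rewrite lfunE. Qed.

Hypothesis phi_l : forall y, linear (phi^~ y).
Hypothesis phi_r : forall x, linear (phi x).
Hypothesis phi_alt : forall x, phi x x = 0.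

Lemma wedge_liftE x y : wedge_lift (wedge x y) = phi x y.
Proof.
have phi_suml I (r : seq I) F (z : V) :
    phi (\sum_(i <- r) F i) z = \sum_(i <- r) phi (F i) z.
  pose f : {linear V -> W} :=
    HB.pack (phi^~ z) (GRing.isLinear.Build K V W _ _ (phi_l z)).
  exact: (linear_sum f).
have phi_sumr I (r : seq I) F (z : V) :
    phi z (\sum_(i <- r) F i) = \sum_(i <- r) phi z (F i).
  pose f : {linear V -> W} :=
    HB.pack (phi z) (GRing.isLinear.Build K V W _ _ (phi_r z)).
  exact: (linear_sum f).
have phiZl a u z : phi (a *: u) z = a *: phi u z.
  pose f : {linear V -> W} :=
    HB.pack (phi^~ z) (GRing.isLinear.Build K V W _ _ (phi_l z)).
  exact: (linearZ_LR f).
have phiZr a u z : phi z (a *: u) = a *: phi z u.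
  pose f : {linear V -> W} :=
    HB.pack (phi z) (GRing.isLinear.Build K V W _ _ (phi_r z)).
  exact: (linearZ_LR f).
have phiNC u v : phi u v = - phi v u.
  apply/eqP; rewrite -addr_eq0; apply/eqP.
  have := phi_alt (u + v).
  have := phi_l (u + v) 1 u v; have := phi_r u 1 u v; have := phi_r v 1 u v.
  by rewrite !scale1r => -> -> ->; rewrite !phi_alt add0r addr0.
pose c i := coord e i x; pose d i := coord e i y.
have Ephi : phi x y = \sum_i \sum_j (c i * d j) *: phi e`_i e`_j.
  rewrite {1}(coord_vbasis (memvf x)) phi_suml.
  apply: eq_bigr => i _; rewrite phiZl {1}(coord_vbasis (memvf y)) phi_sumr.
  by rewrite scaler_sumr; apply: eq_bigr => j _; rewrite phiZr scalerA.
rewrite wedge_lift_sum Ephi pair_big /=.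
rewrite (bigID (fun p : 'I_(\dim {:V}) * 'I_(\dim {:V}) => (p.1 < p.2)%N)) /=.
rewrite [X in _ = _ + X](bigID (fun p : 'I_(\dim {:V}) * 'I_(\dim {:V}) => (p.2 < p.1)%N)) /=.
rewrite [X in _ = _ + (_ + X)]big1 ?addr0; last first.
  move=> [i j] /=; rewrite -!leqNgt -eqn_leq => /eqP/val_inj ->.
  by rewrite phi_alt scaler0.
rewrite [X in _ = _ + X](reindex_inj (h := fun p => (p.2, p.1))) /=; last first.
  by move=> [a b] [a' b'] [-> ->].
rewrite [X in _ = _ + X](eq_bigl (fun p : 'I_(\dim {:V}) * 'I_(\dim {:V}) => (p.1 < p.2)%N)); last first.
  by move=> [i j] /=; case: ltngtP.
rewrite -big_split /=.
rewrite (@reindex_omap _ _ _ _ _ (val : wedge_index -> _) insub); last first.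
  by move=> p lt_p; rewrite insubT.
apply: eq_big => [p|p _]; first by rewrite /= (valP p) valK eqxx.
by rewrite ffunE scalerBl [phi e`_(val p).2 _]phiNC scalerN.
Qed.

Lemma wedge_lift_uniq (F : 'Hom(wedge2, W)) :
  (forall x y, F (wedge x y) = phi x y) -> F = wedge_lift.
Proof.
move=> FE; apply/lfunP => X.
have ee := coord_free _ _ (basis_free (vbasisP {:V})).
have wedgeE (p q : wedge_index) :
    wedge e`_(val p).1 e`_(val p).2 q = (p == q)%:R.
  have -> : (p == q) = (val p == val q) by rewrite val_eqE.
  rewrite ffunE !ee.
  have := valP p; have := valP q; move: (val p) (val q) => [a b] [c d] /=.
  rewrite xpair_eqE => lt_cd lt_ab.
  case: (a =P d) => [Ead|_]; last by rewrite mul0r subr0 -natrM mulnb.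
  case: (b =P c) => [Ebc|_]; last by rewrite mulr0 subr0 -natrM mulnb.
  by move: lt_ab lt_cd; rewrite Ead Ebc ltnNge => /negP nba /ltnW.
have -> : X = \sum_(p : wedge_index) X p *: wedge e`_(val p).1 e`_(val p).2.
  apply/ffunP => q; rewrite sum_ffunE (bigD1 q) //= big1 ?addr0.
    by rewrite ffunE wedgeE eqxx /GRing.scale /= mulr1.
  by move=> p npq; rewrite ffunE wedgeE (negPf npq) scaler0.
rewrite !linear_sum; apply: eq_bigr => p _.
by rewrite !linearZ /= FE wedge_liftE.
Qed.

End Lift.
End Wedge2.

(* The brackets are curried bundled linear maps, so that multilinearity is    *)
(* part of their type.                                                        *)
HB.mixin Record Vector_isLieYamaguti (K : fieldType) g of Vector K g := {
  lyb : 'Hom(g, 'Hom(g, g));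
  lyt : 'Hom(g, 'Hom(g, 'Hom(g, g)));
  lybxx : forall x, lyb x x = 0;
  lytxx : forall x, lyt x x = 0;
  ly1 : forall x y z,
    lyb (lyb x y) z + lyb (lyb y z) x + lyb (lyb z x) y
      + lyt x y z + lyt y z x + lyt z x y = 0;
  ly2 : forall x y z w,
    lyt (lyb x y) z w + lyt (lyb y z) x w + lyt (lyb z x) y w = 0;
  ly3 : forall x y z w,
    lyt x y (lyb z w) = lyb (lyt x y z) w + lyb z (lyt x y w);
  ly4 : forall x y z w t,
    lyt x y (lyt z w t)
      = lyt (lyt x y z) w t + lyt z (lyt x y w) t + lyt z w (lyt x y t)
}.

#[short(type="lieYamagutiType")]
HB.structure Definition LieYamaguti (K : fieldType) :=
  {g of Vector K g & Vector_isLieYamaguti K g}.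

Notation "[< x , y >]" := (lyb x y)
  (at level 0, x, y at level 99, format "[<  x ,  y  >]") : ring_scope.
Notation "[< x , y , z >]" := (lyt x y z)
  (at level 0, x, y, z at level 99, format "[<  x ,  y ,  z  >]") : ring_scope.

Definition is_ly_hom (K : fieldType) (g g' : lieYamagutiType K)
    (f : 'Hom(g, g')) : Prop :=
  (forall x y, f [< x, y >] = [< f x, f y >]) /\
  (forall x y z, f [< x, y, z >] = [< f x, f y, f z >]).

Definition in_center (K : fieldType) (h : lieYamagutiType K) (x : h) : Prop :=
  forall y z : h, [/\ [< x, y >] = 0, [< x, y, z >] = 0 & [< y, z, x >] = 0].

Definition commlf (K : fieldType) (V : vectType K) (f f' : 'End(V)) : 'End(V) :=
  (f \o f')%VF - (f' \o f)%VF.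

(* D_{rho,mu}, for an arbitrary bilinear bracket br on U: it is used both for *)
(* the bracket of g and for the descent bracket [.,.]_T on h.                 *)
Definition Dmap (K : fieldType) (U V : vectType K) (br : U -> U -> U)
    (rho : U -> 'End(V)) (mu : U -> U -> 'End(V)) (x y : U) : 'End(V) :=
  mu y x - mu x y + commlf (rho x) (rho y) - rho (br x y).

Section Combinations.

Variables (K : fieldType) (U V : vectType K).
Implicit Types (a : K) (f : 'Hom(U, V)) (x y : U) (u v : V).

Lemma homP f a x y : f (a *: x + y) = a *: f x + f y.
Proof. exact: linearP. Qed.

Lemma homPl a f f' x : (a *: f + f') x = a *: f x + f' x.
Proof. by rewrite add_lfunE scale_lfunE. Qed.

Lemma combD a u u' v v' :
  (a *: u + u') + (a *: v + v') = a *: (u + v) + (u' + v').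
Proof. by rewrite scalerDr addrACA. Qed.

Lemma combB a u u' v v' :
  (a *: u + u') - (a *: v + v') = a *: (u - v) + (u' - v').
Proof. by rewrite scalerBr opprD addrACA. Qed.

End Combinations.

Section Action.

Variables (K : fieldType) (g : lieYamagutiType K).

Local Notation D rho mu :=
  (Dmap (fun x y => [< x, y >]) rho (fun x y => mu x y)).

Definition is_representation (V : vectType K)
    (rho : 'Hom(g, 'End(V))) (mu : 'Hom(g, 'Hom(g, 'End(V)))) : Prop :=
  [/\ forall x y z,
        mu [< x, y >] z - (mu x z \o rho y)%VF + (mu y z \o rho x)%VF = 0,
      forall x y z,
        mu x [< y, z >] - (rho y \o mu x z)%VF + (rho z \o mu x y)%VF = 0,
      forall x y z,
        rho [< x, y, z >] = commlf (D rho mu x y) (rho z),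
      forall x y z w,
        (mu z w \o mu x y)%VF - (mu y w \o mu x z)%VF - mu x [< y, z, w >]
          + (D rho mu y z \o mu x w)%VF = 0
    & forall x y z w,
        mu [< x, y, z >] w + mu z [< x, y, w >]
        = commlf (D rho mu x y) (mu z w)].

Variable h : lieYamagutiType K.

Record is_action (rho : 'Hom(g, 'End(h))) (mu : 'Hom(g, 'Hom(g, 'End(h)))) :
    Prop := IsAction {
  action_repr : is_representation rho mu;
  action_rho_center : forall x u, in_center (rho x u);
  action_mu_center : forall x y u, in_center (mu x y u);
  action_rho_lyb : forall x u v, rho x [< u, v >] = 0;
  action_mu_lyb : forall x y u v, mu x y [< u, v >] = 0;
  action_rho_lyt : forall x u v w, rho x [< u, v, w >] = 0;
  action_mu_lyt : forall x y u v w, mu x y [< u, v, w >] = 0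
}.

Variables (rho : 'Hom(g, 'End(h))) (mu : 'Hom(g, 'Hom(g, 'End(h)))).

Definition actD : g -> g -> 'End(h) := D rho mu.

Section Operator.

Variable T : 'Hom(h, g).

Definition descent_lyb (u v : h) : h :=
  rho (T u) v - rho (T v) u + [< u, v >].

Definition descent_lyt (u v w : h) : h :=
  actD (T u) (T v) w + mu (T v) (T w) u - mu (T u) (T w) v + [< u, v, w >].

(* Relative Rota-Baxter operators of weight 1. *)
Definition is_rRB : Prop :=
  (forall u v, [< T u, T v >] = T (descent_lyb u v)) /\
  (forall u v w, [< T u, T v, T w >] = T (descent_lyt u v w)).

Definition descent_rho (u : h) : 'End(g) :=
  linfun (fun x => [< T u, x >] + T (rho x u)).

Definition descent_mu (u v : h) : 'End(g) :=
  linfun (fun x => [< x, T u, T v >] - T (actD x (T u) v - mu x (T v) u)).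

Definition descent_D : h -> h -> 'End(g) :=
  Dmap descent_lyb descent_rho descent_mu.

Definition boundary_wedge (x y : g) : 'Hom(h, g) :=
  (T \o actD x y)%VF - (lyt x y \o T)%VF.

Definition boundary : 'Hom(wedge2 g, 'Hom(h, g)) := wedge_lift boundary_wedge.

End Operator.

Definition wedgeL : 'Hom(wedge2 g, 'End(g)) := wedge_lift (fun x y => lyt x y).
Definition wedgeD : 'Hom(wedge2 g, 'End(h)) := wedge_lift actD.

(* Homomorphisms from T' to T. *)
Record is_rRB_hom (T' T : 'Hom(h, g)) (psig : 'End(g)) (psih : 'End(h)) :
    Prop := IsRRBHom {
  rRB_hom_g : is_ly_hom psig;
  rRB_hom_h : is_ly_hom psih;
  rRB_homT : (psig \o T' = T \o psih)%VF;
  rRB_hom_rho : forall x u, psih (rho x u) = rho (psig x) (psih u);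
  rRB_hom_mu : forall x y u, psih (mu x y u) = mu (psig x) (psig y) (psih u)
}.

Definition is_linear_deformation (T S : 'Hom(h, g)) : Prop :=
  forall t : K, is_rRB (T + t *: S).

Definition deformations_equivalent (T S1 S2 : 'Hom(h, g)) : Prop :=
  exists X : wedge2 g, forall t : K,
    is_rRB_hom (T + t *: S2) (T + t *: S1)
               (\1 + t *: wedgeL X)%VF (\1 + t *: wedgeD X)%VF.

Lemma lybC (x y : g) : [< x, y >] = - [< y, x >].
Proof.
apply/eqP; rewrite -addr_eq0; apply/eqP.
have := lybxx (x + y).
by rewrite !linearD /= !add_lfunE !lybxx add0r addr0 addrC.
Qed.

Lemma lytC (x y : g) : lyt x y = - lyt y x.
Proof.
apply/eqP; rewrite -addr_eq0; apply/eqP.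
have := lytxx (x + y).
by rewrite !linearD /= !add_lfunE !lytxx add0r addr0 addrC.
Qed.

Lemma lytPl a (x x' y z : g) :
  [< a *: x + x', y, z >] = a *: [< x, y, z >] + [< x', y, z >].
Proof. by rewrite homP !homPl. Qed.

Lemma lytPm a (x y y' z : g) :
  [< x, a *: y + y', z >] = a *: [< x, y, z >] + [< x, y', z >].
Proof. by rewrite homP homPl. Qed.

Lemma actDE x y u :
  actD x y u = mu y x u - mu x y u + (rho x (rho y u) - rho y (rho x u))
               - rho [< x, y >] u.
Proof.
by rewrite /actD /Dmap /commlf !(add_lfunE, opp_lfunE, comp_lfunE).
Qed.

Lemma actDxx x : actD x x = 0.
Proof. by rewrite /actD /Dmap /commlf lybxx linear0 !subrr addr0 subr0. Qed.

Lemma actDC x y : actD x y = - actD y x.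
Proof.
apply/lfunP => u; rewrite [RHS]opp_lfunE !actDE lybC linearN opp_lfunE /=.
by rewrite !opprD !opprK [mu y x u - _]addrC [rho x _ - _]addrC.
Qed.

Lemma actD_linearl y : linear (actD^~ y).
Proof.
move=> a x x'; apply/lfunP => u.
by rewrite [RHS]homPl !actDE !homP !homPl ?homP !homPl
  !(combB, combD).
Qed.

Lemma actD_linearr x : linear (actD x).
Proof.
move=> a y y'; rewrite actDC (actDC x y) (actDC x y') actD_linearl.
by rewrite opprD scalerN.
Qed.

Lemma boundary_wedgeE T x y v :
  boundary_wedge T x y v = T (actD x y v) - [< x, y, T v >].
Proof. by rewrite /boundary_wedge add_lfunE opp_lfunE !comp_lfunE. Qed.

Lemma boundaryE T x y v :
  boundary T (wedge x y) v = T (actD x y v) - [< x, y, T v >].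
Proof.
rewrite /boundary wedge_liftE ?boundary_wedgeE //.
- move=> y' a z z'; apply/lfunP => u; rewrite [RHS]homPl.
  by rewrite !boundary_wedgeE actD_linearl homPl homP lytPl combB.
- move=> y' a z z'; apply/lfunP => u; rewrite [RHS]homPl.
  by rewrite !boundary_wedgeE actD_linearr homPl homP lytPm combB.
- move=> z; apply/lfunP => u; rewrite boundary_wedgeE actDxx lytxx !lfunE /=.
  by rewrite linear0 subrr.
Qed.

Lemma wedgeLE x y : wedgeL (wedge x y) = lyt x y.
Proof.
rewrite /wedgeL wedge_liftE //; last exact: lytxx.
- by move=> z a u v; rewrite homP homPl.
- by move=> z a u v; rewrite linearP.
Qed.

Lemma wedgeDE x y : wedgeD (wedge x y) = actD x y.
Proof.
rewrite /wedgeD wedge_liftE //; last exact: actDxx.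
- exact: actD_linearl.
- exact: actD_linearr.
Qed.

Section OperatorTheory.

Variable T : 'Hom(h, g).

Lemma descent_rhoE u x : descent_rho T u x = [< T u, x >] + T (rho x u).
Proof.
pose f x := [< T u, x >] + T (rho x u).
have fL : linear f.
  by move=> a y z; rewrite /f !homP homPl homP combD.
pose F : {linear g -> g} := HB.pack f (GRing.isLinear.Build K g g _ f fL).
exact: (lfunE F).
Qed.

Lemma descent_muE u v x :
  descent_mu T u v x
  = [< x, T u, T v >] - T (actD x (T u) v - mu x (T v) u).
Proof.
pose f x := [< x, T u, T v >] - T (actD x (T u) v - mu x (T v) u).
have fL : linear f.
  move=> a y z; rewrite /f actD_linearl homPl lytPl [mu _]homP !homPl.
  by rewrite combB homP combB.
pose F : {linear g -> g} := HB.pack f (GRing.isLinear.Build K g g _ f fL).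
exact: (lfunE F).
Qed.

Definition cocycle1 : {pred 'Hom(h, g)} := fun f => `[<
  (forall u v,
     descent_rho T u (f v) - descent_rho T v (f u) - f (descent_lyb T u v) = 0) /\
  (forall u v w,
     descent_D T u v (f w) + descent_mu T v w (f u) - descent_mu T u w (f v)
       - f (descent_lyt T u v w) = 0) >].

Fact cocycle1_submod_closed : submod_closed cocycle1.
Proof.
split.
  apply/asboolP; split=> *; by rewrite !lfunE /= !linear0 !(subr0, addr0).
move=> a f f' /asboolP[f1 f2] /asboolP[f'1 f'2]; apply/asboolP; split.
  move=> u v; rewrite !homPl !homP !combB.
  by rewrite f1 f'1 scaler0 addr0.
move=> u v w; rewrite !homPl !homP !(combD, combB).
by rewrite f2 f'2 scaler0 addr0.
Qed.

HB.instance Definition _ :=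
  GRing.isSubmodClosed.Build K 'Hom(h, g) cocycle1 cocycle1_submod_closed.

Record Z1 := Cocycle1 { Z1val :> 'Hom(h, g); _ : Z1val \in cocycle1 }.

HB.instance Definition _ := [isSub for Z1val].
HB.instance Definition _ := [Choice of Z1 by <:].
HB.instance Definition _ := [SubChoice_isSubLmodule of Z1 by <:].

Definition B1 : {vspace 'Hom(h, g)} := limg (boundary T).

(* When (rho, mu) is an action and T a relative Rota-Baxter operator, B^1_T   *)
(* is included in Z^1_T, so that this is all of B^1_T.                        *)
Definition B1_in_Z1 : {pred Z1} := fun z => \val z \in B1.

Fact B1_in_Z1_zmod_closed : zmod_closed B1_in_Z1.
Proof.
split; first exact: mem0v.
by move=> z z' zB z'B; rewrite unfold_in /B1_in_Z1 raddfB; apply: rpredB.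
Qed.

HB.instance Definition _ :=
  GRing.isZmodClosed.Build Z1 B1_in_Z1 B1_in_Z1_zmod_closed.

Definition H1 := {ideal_quot B1_in_Z1}.

Definition cohomology_class (z : Z1) : H1 := \pi_H1 z.

Lemma cohomology_classP (z z' : Z1) :
  cohomology_class z = cohomology_class z' <-> Z1val z - Z1val z' \in B1.
Proof.
have -> : (Z1val z - Z1val z' \in B1) = (z - z' \in B1_in_Z1).
  by rewrite [RHS]unfold_in /B1_in_Z1 raddfB.
rewrite Quotient.idealrBE.
by split=> [/eqP|/eqP].
Qed.

End OperatorTheory.
End Action.

(* Main.v *)
Require Import Defs.
From HB Require Import structures.
From mathcomp Require Import all_boot all_order all_algebra.
From mathcomp Require Import boolp ring.

Set Implicit Arguments.
Unset Strict Implicit.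
Unset Printing Implicit Defensive.

Import GRing.Theory.
Local Open Scope ring_scope.

(** A deformation [T + t S] satisfies the Rota-Baxter identities for every [t],
    and both sides of these identities are polynomial in [t]. As [K] is infinite,
    such identities may be differentiated at [t = 0]. The derivative of the
    Rota-Baxter identities is the cocycle condition on [S]
    ([deformation_cocycle]): differentiating [T + t S] wherever it occurs
    produces the terms of [descent_rho], [descent_mu] and [descent_D]. That
    last comparison needs the closed form [descent_DE] of the map [D] attached
    to the descent representation, and this is where the hypotheses on the
    action enter. The derivative of the intertwining relation
    [(1 + t L(X)) (T + t T2) = (T + t T1) (1 + t D(X))] is
    [T2 + L(X) T = T1 + T D(X)], which says that [T1 - T2] is the coboundary of
    [- X] ([equivalence_coboundary]).

    Derivatives are formal: a polynomial curve in a vector space is a linear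
    combination of fixed vectors whose coefficients are polynomials evaluated
    at [t]. The product rule for bilinear maps then comes from the one for
    polynomials, and characteristic zero makes the derivative depend only on
    the values of the curve. *)

(** * Formal derivatives of polynomial curves *)

(** In characteristic zero the images of the natural numbers are pairwise
    distinct, which gives [p] more roots than its degree. *)
Lemma horner0_eq0 (K : fieldType) (charK : [pchar K] =i pred0) (p : {poly K}) :
  (forall t, p.[t] = 0) -> p = 0.
Proof.
move=> p0; apply/eqP/negPn/negP => nz_p.
pose rs : seq K := [seq i%:R | i <- iota 0 (size p)].
have natr_inj : injective (fun i : nat => i%:R : K).
  have wlog_inj i j : (i <= j)%N -> i%:R = j%:R :> K -> i = j.
    move=> le_ij /esym/eqP; rewrite -subr_eq0 -natrB //.
    rewrite (proj1 (pcharf0P K) charK) subn_eq0 => le_ji.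
    by apply/eqP; rewrite eqn_leq le_ij.
  move=> i j Eij; case/orP: (leq_total i j) => le_ij; first exact: wlog_inj.
  by apply/esym; apply: wlog_inj.
have := max_poly_roots (p := p) (rs := rs) nz_p.
rewrite size_map size_iota ltnn => max_roots; apply: notF; apply: max_roots.
  by apply/allP => t _; apply/rootP.
by rewrite map_inj_uniq ?iota_uniq.
Qed.

Section Derivative.

Context {K : fieldType}.

(** The decomposition of a curve is not unique, so the derivative is a
    relation; [is_deriv0_unique] shows that it is functional. *)
Definition is_deriv0 {V : vectType K} (f : K -> V) (df : V) : Prop :=
  exists2 s : seq ({poly K} * V),
    forall t, f t = \sum_(c <- s) c.1.[t] *: c.2
    & df = \sum_(c <- s) c.1^`().[0] *: c.2.

(** Additivity with a fixed head symbol: [linearN] also applies to the opposite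
    itself, so that iterating it on [- - x] never ends. *)
Lemma homD (U V : vectType K) (A : 'Hom(U, V)) x y : A (x + y) = A x + A y.
Proof. exact: linearD. Qed.

Lemma homN (U V : vectType K) (A : 'Hom(U, V)) x : A (- x) = - A x.
Proof. exact: linearN. Qed.

(** Besides reducing uniqueness of derivatives to scalar polynomials, this turns
    additive identities between vectors into identities in [K], for [ring]. *)
Lemma linear_forms_separate (V : vectType K) (x y : V) :
  (forall phi : 'Hom(V, K^o), phi x = phi y) -> x = y.
Proof.
move=> xy; rewrite (coord_vbasis (memvf x)) (coord_vbasis (memvf y)).
apply: eq_bigr => i _; have := xy (linfun (coord (vbasis {:V}) i : V -> K^o)).
by rewrite !lfunE => ->.
Qed.

Lemma is_deriv0_unique (charK : [pchar K] =i pred0) (V : vectType K)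
    (f f' : K -> V) (df df' : V) :
  is_deriv0 f df -> is_deriv0 f' df' -> f =1 f' -> df = df'.
Proof.
move=> [s fE ->] [s' f'E ->] ff'.
apply: linear_forms_separate => phi; rewrite !linear_sum /=.
pose P (r : seq ({poly K} * V)) : {poly K} := \sum_(c <- r) (phi c.2 : K) *: c.1.
have PE r t : (P r).[t] = phi (\sum_(c <- r) c.1.[t] *: c.2).
  rewrite linear_sum horner_sum; apply: eq_bigr => c _.
  by rewrite linearZ hornerZ mulrC.
have dPE r : (P r)^`().[0] = \sum_(c <- r) phi (c.1^`().[0] *: c.2).
  rewrite raddf_sum horner_sum; apply: eq_bigr => c _.
  by rewrite linearZ /= derivZ hornerZ mulrC.
rewrite -!dPE; suff -> : P s = P s' by [].
apply/eqP; rewrite -subr_eq0; apply/eqP.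
apply: horner0_eq0 => // t.
by rewrite hornerD hornerN !PE -fE -f'E ff' subrr.
Qed.

Lemma is_deriv0_affine (V : vectType K) (a b : V) :
  is_deriv0 (fun t => a + t *: b) b.
Proof.
exists [:: (1, a); ('X, b)] => [t|].
  by rewrite !big_cons big_nil addr0 /= hornerC hornerX scale1r.
by rewrite !big_cons big_nil addr0 /= derivC derivX !hornerC scale0r scale1r add0r.
Qed.

Lemma is_deriv0_const (V : vectType K) (a : V) : is_deriv0 (fun=> a) 0.
Proof.
exists [:: (1, a)] => [t|]; rewrite big_seq1 /= ?derivC hornerC.
  by rewrite scale1r.
by rewrite scale0r.
Qed.

Lemma is_deriv0D (V : vectType K) (f f' : K -> V) (df df' : V) :
  is_deriv0 f df -> is_deriv0 f' df' ->
  is_deriv0 (fun t => f t + f' t) (df + df').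
Proof.
move=> [s fE ->] [s' f'E ->]; exists (s ++ s') => [t|]; rewrite big_cat //=.
by rewrite fE f'E.
Qed.

Lemma is_deriv0N (V : vectType K) (f : K -> V) (df : V) :
  is_deriv0 f df -> is_deriv0 (fun t => - f t) (- df).
Proof.
move=> [s fE ->]; exists [seq (c.1, - c.2) | c <- s] => [t|].
  by rewrite big_map fE -sumrN; apply: eq_bigr => c _; rewrite scalerN.
by rewrite big_map -sumrN; apply: eq_bigr => c _; rewrite scalerN.
Qed.

Lemma is_deriv0_bilin (U V W : vectType K) (phi : U -> V -> W)
    (phi_l : forall y, linear (phi^~ y)) (phi_r : forall x, linear (phi x))
    (f : K -> U) (f' : K -> V) (df : U) (df' : V) :
  is_deriv0 f df -> is_deriv0 f' df' ->
  is_deriv0 (fun t => phi (f t) (f' t)) (phi df (f' 0) + phi (f 0) df').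
Proof.
pose phil y : {linear U -> W} :=
  HB.pack (phi^~ y) (GRing.isLinear.Build K U W _ _ (phi_l y)).
pose phir x : {linear V -> W} :=
  HB.pack (phi x) (GRing.isLinear.Build K V W _ _ (phi_r x)).
have phi_suml I (r : seq I) F z :
    phi (\sum_(i <- r) F i) z = \sum_(i <- r) phi (F i) z.
  exact: (linear_sum (phil z)).
have phi_sumr I (r : seq I) F z :
    phi z (\sum_(i <- r) F i) = \sum_(i <- r) phi z (F i).
  exact: (linear_sum (phir z)).
have phiZl a u z : phi (a *: u) z = a *: phi u z.
  exact: (linearZ_LR (phil z)).
have phiZr a u z : phi z (a *: u) = a *: phi z u.
  exact: (linearZ_LR (phir z)).
have phi_sum (s : seq ({poly K} * U)) (s' : seq ({poly K} * V))
    (F F' : {poly K} -> K) :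
  phi (\sum_(c <- s) F c.1 *: c.2) (\sum_(d <- s') F' d.1 *: d.2)
    = \sum_(c <- s) \sum_(d <- s') (F c.1 * F' d.1) *: phi c.2 d.2.
  rewrite phi_suml; apply: eq_bigr => c _.
  rewrite phi_sumr; apply: eq_bigr => d _.
  by rewrite phiZl phiZr scalerA.
move=> [s fE ->] [s' f'E ->].
exists [seq (c.1 * d.1, phi c.2 d.2) | c <- s, d <- s'] => [t|].
  rewrite fE f'E (phi_sum _ _ (fun p => p.[t]) (fun p => p.[t])).
  rewrite big_allpairs_dep; apply: eq_bigr => c _.
  by apply: eq_bigr => d _; rewrite hornerM.
rewrite fE f'E (phi_sum _ _ (fun p => p^`().[0]) (fun p => p.[0])).
rewrite (phi_sum _ _ (fun p => p.[0]) (fun p => p^`().[0])).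
rewrite big_allpairs_dep -big_split; apply: eq_bigr => c _ /=.
rewrite -big_split; apply: eq_bigr => d _ /=.
by rewrite derivM hornerD !hornerM scalerDl.
Qed.

Lemma is_deriv0_app (U V : vectType K) (F : K -> 'Hom(U, V)) (f : K -> U)
    (dF : 'Hom(U, V)) (df : U) :
  is_deriv0 F dF -> is_deriv0 f df ->
  is_deriv0 (fun t => F t (f t)) (dF (f 0) + F 0 df).
Proof.
apply: (@is_deriv0_bilin _ _ _ (fun (F : 'Hom(U, V)) x => F x)).
- by move=> x a F1 F2; rewrite homPl.
- by move=> F1 a x y; rewrite homP.
Qed.

(** The case of a constant map, without the zero term of the product rule. *)
Lemma is_deriv0_lin (U V : vectType K) (A : 'Hom(U, V)) (f : K -> U) (df : U) :
  is_deriv0 f df -> is_deriv0 (fun t => A (f t)) (A df).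
Proof.
move=> /(is_deriv0_app (is_deriv0_const A)).
by rewrite zero_lfunE add0r.
Qed.

Lemma is_deriv0_val (U V : vectType K) (F : K -> 'Hom(U, V))
    (dF : 'Hom(U, V)) (x : U) :
  is_deriv0 F dF -> is_deriv0 (fun t => F t x) (dF x).
Proof.
by move=> /is_deriv0_app/(_ (is_deriv0_const x)); rewrite linear0 addr0.
Qed.

End Derivative.

Section Deformation.

Context {K : fieldType} (charK : [pchar K] =i pred0) {g h : lieYamagutiType K}.
Context {rho : 'Hom(g, 'End(h))} {mu : 'Hom(g, 'Hom(g, 'End(h)))}.
Context (T : 'Hom(h, g)).

Local Notation D := (actD rho mu).

(** * The descent representation *)

(** Since [rho x v] is central and [rho x] kills brackets, the bracket of [h]
    drops out of [[Tu, T (rho x v)]] and of [rho x [u, v]_T]. What remains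
    in the image of [T] cancels except for two terms in [mu], and the part in
    [g] is the triple bracket by (LY1). *)
Lemma descent_DE (act : is_action rho mu) (T_rRB : is_rRB rho mu T) u v x :
  descent_D rho mu T u v x
  = [< T u, T v, x >] - T (mu (T v) x u - mu (T u) x v).
Proof.
have [TB _] := T_rRB.
have TrhoB w w' :
    [< T w, T (rho x w') >] = T (rho (T w) (rho x w') - rho (T (rho x w')) w).
  have [c _ _] := action_rho_center act x w' w w.
  by rewrite TB /descent_lyb lybC c oppr0 addr0.
have rho_descent : rho x (descent_lyb rho T u v)
    = rho x (rho (T u) v) - rho x (rho (T v) u).
  by rewrite /descent_lyb linearD linearB /= (action_rho_lyb act) addr0.
rewrite /descent_D /Dmap /commlf !(add_lfunE, opp_lfunE, comp_lfunE).
rewrite !(descent_rhoE, descent_muE) rho_descent -TB !(homD (lyb _)).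
rewrite !TrhoB !actDE.
have lyuv := ly1 (T u) (T v) x.
have E : [< T u, T v, x >]
    = - ([< [< T u, T v >], x >] + [< [< T v, x >], T u >]
         + [< [< x, T u >], T v >] + [< T v, x, T u >] + [< x, T u, T v >]).
  by apply/eqP; rewrite -addr_eq0 -lyuv; apply/eqP;
     apply: linear_forms_separate => phi; rewrite !homD; ring.
(* Each bracket occurring in two orders is given a single orientation, so that
   the rest is an identity of abelian groups. *)
rewrite E (lytC x (T v)) opp_lfunE [lyb x (T v)]lybC [lyb (T u) x]lybC.
rewrite [lyb (T u) (lyb _ _)]lybC.
rewrite (lybC (T v) (- _)).
apply: linear_forms_separate => phi.
rewrite !(homN rho, homD rho) (homN lyb) !(add_lfunE, opp_lfunE).
rewrite !(homN T, homD T) !(homN phi, homD phi).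
ring.
Qed.

(** * Infinitesimal deformations are cocycles *)

Context (S : 'Hom(h, g)).

(** Both cocycle identities are the derivatives at [t = 0] of the two
    Rota-Baxter identities of [T + t S]. *)
Lemma deformation_cocycle (act : is_action rho mu) (T_rRB : is_rRB rho mu T) :
  is_linear_deformation rho mu T S -> S \in cocycle1 rho mu T.
Proof.
move=> S_def.
have dT := is_deriv0_affine T S.
have T0 : T + 0 *: S = T by rewrite scale0r addr0.
have dTv u := is_deriv0_val u dT.
have dD u v w :
    is_deriv0 (fun t => D ((T + t *: S) u) ((T + t *: S) v) w)
              (D (S u) (T v) w + D (T u) (S v) w).
  have := is_deriv0_val w
    (is_deriv0_bilin (actD_linearl rho mu) (actD_linearr rho mu) (dTv u) (dTv v)).
  by rewrite T0 add_lfunE.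
have dmu u v w :
    is_deriv0 (fun t => mu ((T + t *: S) u) ((T + t *: S) v) w)
              (mu (S u) (T v) w + mu (T u) (S v) w).
  have := is_deriv0_val w (is_deriv0_app (is_deriv0_lin mu (dTv u)) (dTv v)).
  by rewrite T0 add_lfunE.
have drho u v : is_deriv0 (fun t => rho ((T + t *: S) u) v) (rho (S u) v).
  exact: is_deriv0_val (is_deriv0_lin rho (dTv u)).
(* In both cases the cocycle identity is the equation [dE] between derivatives,
   with the terms in the image of [T] moved to the other side. *)
apply/asboolP; split=> [u v|u v w].
  have dL := is_deriv0_app (is_deriv0_lin lyb (dTv u)) (dTv v).
  have dR := is_deriv0_app dT
    (is_deriv0D (is_deriv0D (drho u v) (is_deriv0N (drho v u)))
                (is_deriv0_const [< u, v >])).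
  have := is_deriv0_unique charK dL dR (fun t => (S_def t).1 u v).
  rewrite /= !T0 => dE.
  rewrite !descent_rhoE.
  apply/eqP; rewrite subr_eq0; apply/eqP.
  rewrite -[RHS](addrK (T (rho (S u) v - rho (S v) u + 0))) -dE.
  rewrite (lybC (T v)) addr0.
  by apply: linear_forms_separate => phi; rewrite !(homD, homN); ring.
have dL := is_deriv0_app
  (is_deriv0_app (is_deriv0_lin lyt (dTv u)) (dTv v)) (dTv w).
have dR := is_deriv0_app dT
  (is_deriv0D (is_deriv0D (is_deriv0D (dD u v w) (dmu v w u))
                          (is_deriv0N (dmu u w v)))
              (is_deriv0_const [< u, v, w >])).
have := is_deriv0_unique charK dL dR (fun t => (S_def t).2 u v w).
rewrite /= !T0 => dE.
rewrite descent_DE // !descent_muE.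
apply/eqP; rewrite subr_eq0; apply/eqP.
rewrite -[RHS](addrK (T (D (S u) (T v) w + D (T u) (S v) w +
  (mu (S v) (T w) u + mu (T v) (S w) u) -
  (mu (S u) (T w) v + mu (T u) (S w) v) + 0))) -dE.
rewrite (lytC (S v)) (actDC rho mu (S v)) addr0.
apply: linear_forms_separate => phi.
by rewrite !(opp_lfunE, add_lfunE) !(homN T, homD T) !(homN phi, homD phi); ring.
Qed.

(** * Equivalent deformations differ by a coboundary *)

(** The definition by linear extension gives this for every [X], without
    writing [X] as a sum of decomposable elements. *)
Lemma boundary_liftE X v :
  boundary rho mu T X v = T (wedgeD rho mu X v) - wedgeL g X (T v).
Proof.
rewrite /boundary /wedgeD /wedgeL !wedge_lift_sum !sum_lfunE linear_sum -sumrB.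
apply: eq_bigr => p _; rewrite !scale_lfunE boundary_wedgeE linearZ /=.
by rewrite scalerBr.
Qed.

(** The coefficient of [t] in the relation between the two deformations
    identifies [T1 - T2] with the boundary of [- X]. *)
Lemma equivalence_coboundary (T1 T2 : 'Hom(h, g)) :
  deformations_equivalent rho mu T T1 T2 -> T1 - T2 \in B1 rho mu T.
Proof.
move=> [X X_hom].
suff -> : T1 - T2 = boundary rho mu T (- X) by apply: memv_img; exact: memvf.
apply/lfunP => v.
rewrite linearN !(add_lfunE, opp_lfunE) boundary_liftE.
have dL := is_deriv0_app (is_deriv0_affine \1%VF (wedgeL g X))
                         (is_deriv0_val v (is_deriv0_affine T T2)).
have dR := is_deriv0_app (is_deriv0_affine T T1)
  (is_deriv0_val v (is_deriv0_affine \1%VF (wedgeD rho mu X))).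
have := is_deriv0_unique charK dL dR.
rewrite /= !scale0r !addr0 !id_lfunE => dE.
have {}dE : wedgeL g X (T v) + T2 v = T1 v + T (wedgeD rho mu X v).
  by apply: dE => t; have /lfunP/(_ v) := rRB_homT (X_hom t);
     rewrite !comp_lfunE.
by rewrite opprB -[T1 v](addrK (T (wedgeD rho mu X v))) -dE addrAC addrK.
Qed.

End Deformation.

Theorem theorem5p10 (K : fieldType) (charK : [pchar K] =i pred0)
    (g h : lieYamagutiType K)
    (rho : 'Hom(g, 'End(h))) (mu : 'Hom(g, 'Hom(g, 'End(h))))
    (act : is_action rho mu)
    (T : 'Hom(h, g)) (T_rRB : is_rRB rho mu T)
    (T1 T2 : 'Hom(h, g))
    (T1_def : is_linear_deformation rho mu T T1)
    (T2_def : is_linear_deformation rho mu T T2)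
    (T12_equiv : deformations_equivalent rho mu T T1 T2) :
  exists z1 z2 : Z1 rho mu T,
    [/\ Z1val z1 = T1, Z1val z2 = T2
      & cohomology_class z1 = cohomology_class z2].
Proof.
have Z_T1 := deformation_cocycle charK act T_rRB T1_def.
have Z_T2 := deformation_cocycle charK act T_rRB T2_def.
exists (Cocycle1 Z_T1), (Cocycle1 Z_T2); split=> //.
by apply/cohomology_classP; apply: equivalence_coboundary.
Qed.
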